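(* Let $\alpha$ be a $k$-adic monotone connective such that $A_\alpha(p)<p$ on the interval $(0,1)$, $k>2$ and $\beta_{k-1}\le\frac{k-2}{k}$. There exists a constant $c_\alpha$ such that for all $n>0$, for the growth process $(\mu,\alpha)$ on $n$ variables with $\mu$ uniform on the $n$ projections and with limiting distribution $\pi$: if $i\ge 3\log(n)+c_\alpha$, then for all $n$-adic Boolean functions $f$, $|\pi_i(f)-\pi(f)|<2^{-n}$.
   Context: A connective is a $k$-adic Boolean function $\alpha:\{0,1\}^k\to\{0,1\}$. Its characteristic polynomial is $A_\alpha(p)=\Pr[\alpha(X_1,\dots,X_k)=1]=\sum_{j=0}^k\beta_j\binom kj p^j(1-p)^{k-j}$, where the $X_j$ are independent binary variables each equal to 1 with probability $p$, and $\beta_j$ is the fraction of assignments of weight $j$ for which $\alpha$ is true. The growth process $(\mu,\alpha)$ gives distributions $\pi_i$ on $n$-adic Boolean functions: $\pi_0=\mu$, and for $i\ge1$, $\pi_i(f)$ is the probability that $\alpha(g_1,\dots,g_k)=f$ where $g_1,\dots,g_k$ are independent random functions distributed according to $\pi_{i-1}$. The limiting distribution is $\pi=\lim_{i\to\infty}\pi_i$ (pointwise). Logarithms are to base 2. *)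

(* Defs.v *)
From HB Require Import structures.
From mathcomp Require Import all_boot all_order all_algebra.
From mathcomp Require Import all_classical all_reals all_analysis.

Set Implicit Arguments.
Unset Strict Implicit.
Unset Printing Implicit Defensive.

Import Order.TTheory GRing.Theory Num.Theory.
Import numFieldNormedType.Exports.

Local Open Scope ring_scope.

Definition assignment (n : nat) := {ffun 'I_n -> bool}.

(* Connectives are the elements of [boolfun k], and the growth process produces
   elements of [boolfun n]. *)
Definition boolfun (n : nat) := {ffun assignment n -> bool}.

Definition weight (n : nat) (x : assignment n) : nat := #|[set j | x j]|.

Definition monotone_boolfun (n : nat) (f : boolfun n) : Prop :=
  forall x y : assignment n, (forall j, x j ==> y j) -> f x ==> f y.

Definition beta (R : realType) (k : nat) (alpha : boolfun k) (j : nat) : R :=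
  #|[set x : assignment k | (weight x == j) && alpha x]|%:R /
  #|[set x : assignment k | weight x == j]|%:R.

Definition connective_poly (R : realType) (k : nat) (alpha : boolfun k)
    : {poly R} :=
  \sum_(j < k.+1)
    (beta R alpha j * 'C(k, j)%:R) *: ('X^j * (1 - 'X) ^+ (k - j)).

Lemma card_weight (k j : nat) :
  #|[set x : assignment k | weight x == j]| = 'C(k, j).
Proof.
rewrite -[in RHS](card_ord k) -card_draws.
pose g (x : assignment k) := [set i | x i].
have gI : injective g.
  by move=> x y /finset.setP e; apply/ffunP => i; have := e i; rewrite !inE.
rewrite -(card_imset _ gI); apply: eq_card => A; rewrite !inE.
apply/imsetP/idP => [[x + ->]|hA]; first by rewrite inE.
have gA : g [ffun i => i \in A] = A.
  by apply/finset.setP => i; rewrite inE ffunE.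
by exists [ffun i => i \in A]; rewrite ?inE ?/weight -?/(g _) gA.
Qed.

(* [(connective_poly R alpha).[p]] is the probability that
   [alpha (X_1, ..., X_k) = 1] for independent Bernoulli(p) variables [X_j]. *)
Lemma connective_polyE (R : realType) (k : nat) (alpha : boolfun k) (p : R) :
  (connective_poly R alpha).[p] =
  \sum_(x : assignment k | alpha x) \prod_(j < k) (if x j then p else 1 - p).
Proof.
have wlt (x : assignment k) : (weight x < k.+1)%N.
  by rewrite ltnS -[k in leqRHS]card_ord max_card.
rewrite (partition_big (fun x => Ordinal (wlt x)) xpredT) //=.
rewrite /connective_poly horner_sum; apply: eq_bigr => j _.
have -> : beta R alpha j * 'C(k, j)%:R =
    #|[set x : assignment k | (weight x == j) && alpha x]|%:R.
  rewrite /beta card_weight mulfVK //.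
  by rewrite pnatr_eq0 -lt0n bin_gt0 -ltnS.
rewrite hornerZ hornerM hornerXn horner_exp hornerD hornerN hornerX hornerC.
rewrite (eq_bigr (fun=> p ^+ j * (1 - p) ^+ (k - j))); last first.
  move=> x /andP[_ /eqP <-] /=.
  rewrite (bigID (fun i => x i)) /=; congr (_ * _).
    rewrite (eq_bigr (fun=> p)) => [|i ->//].
    by rewrite prodr_const /weight cardsE.
  rewrite (eq_bigr (fun=> 1 - p)) => [|i /negbTE ->//].
  rewrite prodr_const; congr (_ ^+ _).
  have cE : (#|~: [set j | x j]| = k - weight x)%N.
    by rewrite cardsCs finset.setCK card_ord.
  by rewrite -cE; apply: eq_card => i; rewrite !inE.
rewrite sumr_const -[RHS]mulr_natl; congr (_ * _).
congr (_%:R); apply: eq_card => x.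
by rewrite !inE /in_mem /= andbC -val_eqE.
Qed.

Definition projection (n : nat) (j : 'I_n) : boolfun n := [ffun x : assignment n => x j].

Definition uniform_projections (R : realType) (n : nat) (f : boolfun n) : R :=
  if f \in codom (@projection n) then n%:R^-1 else 0.

Definition boolfun_comp (k n : nat) (alpha : boolfun k)
    (g : {ffun 'I_k -> boolfun n}) : boolfun n :=
  [ffun x : assignment n => alpha [ffun j => g j x]].

(* Distributions on the finite type [boolfun n] are given by their mass
   functions; independence of the [g_j] is the product of the masses. *)
Fixpoint growth (R : realType) (k n : nat) (mu : boolfun n -> R)
    (alpha : boolfun k) (i : nat) (f : boolfun n) : R :=
  if i is i'.+1 then
    \sum_(g : {ffun 'I_k -> boolfun n} | boolfun_comp alpha g == f)
      \prod_(j < k) growth mu alpha i' (g j)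
  else mu f.

Definition growth_limit (R : realType) (k n : nat) (mu : boolfun n -> R)
    (alpha : boolfun k) (f : boolfun n) : R :=
  limn (fun i => growth mu alpha i f).

Definition log2 (R : realType) (x : R) : R := ln x / ln 2.

(* Main.v *)
(** If [alpha] is not constantly false, every function in the support of the
    process is monotone and true at the all-ones assignment, so it differs from
    the conjunction of all variables only if it is true at one of the [n]
    assignments of weight [n - 1].  Each of these events has probability
    [A^i (1 - 1/n)], where [A] is the characteristic polynomial.  Starting at
    distance [1/n] from 1, the iterates move away from 1 by a factor 3/2 per
    step (the slope of [A] at 1 is at least 2), so about [2 log n] steps bring
    them below a constant less than 1.  Constantly many steps then bring them
    near 0, since [p - A p] is bounded below on compact subsets of (0, 1).  Near
    0 they decay doubly exponentially, since [A p <= 2^k p^2]; another [log n]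
    steps reach [4^-n]. *)
Require Import Defs.
From mathcomp Require Import all_boot all_order all_algebra.
From mathcomp Require Import all_classical all_reals all_analysis.
From mathcomp Require Import ring lra zify.

Import Order.TTheory GRing.Theory Num.Theory.
Import numFieldNormedType.Exports.

Set Implicit Arguments.
Unset Strict Implicit.

Local Open Scope ring_scope.

(** * Iteration of real maps that repel from 1 and attract quadratically to 0 *)

Lemma bernoulli_le (R : realDomainType) (e : R) (m : nat) :
  0 <= e <= 1 -> 1 - m%:R * e <= (1 - e) ^+ m.
Proof.
move=> /andP[e0 e1]; elim: m => [|m IH]; first by rewrite expr0 mul0r subr0.
rewrite exprS -natr1.
have : (1 - e) * (1 - m%:R * e) <= (1 - e) * (1 - e) ^+ m.
  by apply: ler_wpM2l IH; rewrite subr_ge0.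
have : 0 <= m%:R * e ^+ 2 by rewrite mulr_ge0 ?ler0n ?sqr_ge0.
nra.
Qed.

(** If [u m] were above [1 - e], all earlier terms would be too, so the gap to 1 would grow by [r]
    at every step and reach 1, forcing [u m <= 0]. *)
Lemma decreasing_expanding_le (R : realFieldType) (u : nat -> R) (e d r : R)
    (m : nat) :
  0 <= r -> e < 1 -> (forall i, 0 <= u i) -> (forall i, u i.+1 <= u i) ->
  (forall i, 1 - e <= u i -> r * (1 - u i) <= 1 - u i.+1) ->
  d <= 1 - u 0%N -> 1 <= r ^+ m * d ->
  u m <= 1 - e.
Proof.
move=> r0 e1 u0 ud uexp hd hm; rewrite leNgt; apply/negP => um.
have dec : {homo u : i j / (i <= j)%N >-> j <= i}.
  exact/nonincreasing_seqP.
suff /(_ m (leqnn m)) : forall i, (i <= m)%N -> r ^+ i * d <= 1 - u i.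
  by move=> h; have := u0 m; lra.
elim=> [|i IH] im; first by rewrite expr0 mul1r.
have ui : 1 - e <= u i by rewrite (le_trans (ltW um)) ?dec // ltnW.
apply: le_trans (uexp i ui).
by rewrite exprS -mulrA ler_wpM2l // IH // ltnW.
Qed.

(** By compactness [p - f p] has a positive minimum [d] on [[a, b]], so more than [(b - a) / d]
    steps cannot all stay there. [T] is chosen before [u], which later makes it independent of
    [n]. *)
Lemma decreasing_crosses (R : realType) (f : R -> R) (a b : R) :
  a <= b -> continuous f -> (forall p, a <= p <= b -> f p < p) ->
  exists T : nat, forall u : nat -> R,
    (forall i, u i.+1 = f (u i)) -> (forall i, u i.+1 <= u i) ->
    u 0%N <= b -> u T <= a.
Proof.
move=> ab cf flt.
have cg : {within `[a, b], continuous (fun p => p - f p)}%classic.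
  by apply: continuous_subspaceT => p; apply: cvgB => //; apply: cf.
have [c cab cmin] := EVT_min ab cg.
set d := c - f c in cmin.
have d0 : 0 < d by rewrite subr_gt0 flt //; move: cab; rewrite in_itv.
exists (Num.truncn ((b - a) / d)).+1 => u uE ud ub.
have hT := truncnS_gt ((b - a) / d).
set T := (Num.truncn _).+1 in hT *.
rewrite leNgt; apply/negP => ua.
have dec : {homo u : i j / (i <= j)%N >-> j <= i}.
  exact/nonincreasing_seqP.
suff /(_ T (leqnn T)) : forall i, (i <= T)%N -> u i <= b - i%:R * d.
  by move: hT; rewrite ltr_pdivrMr // => h1 h2; lra.
elim=> [|i IH] iT; first by rewrite mul0r subr0.
have := IH (ltnW iT).
have uab : u i \in `[a, b].
  rewrite in_itv /= (le_trans (ltW ua)) ?dec 1?ltnW //=.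
  by rewrite (le_trans (dec 0%N i _)).
have := cmin _ uab; rewrite uE -natr1 /=; lra.
Qed.

(** Rescaling absorbs the constant: [C * u j] is at most squared at each step, and it dominates
    [u j] because [1 <= C]. *)
Lemma quadratic_decay (R : realFieldType) (u : nat -> R) (C : R) :
  1 <= C -> (forall i, 0 <= u i) -> (forall i, u i.+1 <= C * u i ^+ 2) ->
  C * u 0%N <= 4^-1 -> forall j, u j <= 4^-1 ^+ (2 ^ j).
Proof.
move=> C1 u0 uq h j.
have C0 : 0 <= C by lra.
suff : C * u j <= 4^-1 ^+ (2 ^ j).
  by apply: le_trans; rewrite ler_peMl.
elim: j => [|j IH]; first by rewrite expn0 expr1.
have Cu0 : 0 <= C * u j by rewrite mulr_ge0.
rewrite expnSr exprM; apply: (@le_trans _ _ ((C * u j) ^+ 2)).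
  by rewrite exprMn (expr2 C) -mulrA ler_wpM2l.
by rewrite ler_pXn2r // nnegrE exprn_ge0 // invr_ge0 ler0n.
Qed.

Lemma iter_superexp_decay (R : realType) (A : R -> R) (C e : R) :
  continuous A -> 1 <= C -> 0 < e < 1 ->
  (forall p, 0 <= p <= 1 -> 0 <= A p <= C * p ^+ 2) ->
  (forall p, 0 < p < 1 -> A p < p) ->
  (forall p, 1 - e <= p <= 1 -> 3 / 2 * (1 - p) <= 1 - A p) ->
  exists T : nat, forall n J j : nat, (0 < n)%N -> (n <= 2 ^ J)%N ->
    iter (J.*2 + T + j) A (1 - n%:R^-1) <= 4^-1 ^+ (2 ^ j).
Proof.
move=> cA C1 /andP[e0 e1] A0 Alt A1.
have C0 : 0 < C by lra.
(* Below [C^-1 * 4^-1] the quadratic regime starts; the minimum with [1 - e] keeps the middle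
   interval [[a, 1 - e]] well ordered. *)
set a := Num.min (C^-1 * 4^-1) (1 - e).
have a0 : 0 < a by rewrite lt_min subr_gt0 e1 andbT mulr_gt0 ?invr_gt0.
have ae : a <= 1 - e by rewrite ge_min lexx orbT.
have [|T hT] := @decreasing_crosses R A a (1 - e) ae cA.
  by move=> p /andP[p1 p2]; apply: Alt; apply/andP; split; lra.
exists T => n J j n0 nJ.
have nr0 : 0 < n%:R :> R by rewrite ltr0n.
set u := fun i => iter i A (1 - n%:R^-1).
have uS i : u i.+1 = A (u i) by [].
have ur i : 0 <= u i < 1.
  elim: i => [|i /andP[h1 h2]].
    by rewrite /u /= subr_ge0 ltrBlDr ltrDl invr_gt0 nr0 invf_le1 // ler1n n0.
  have /andP[h0 h3] : 0 <= A (u i) <= C * u i ^+ 2 by apply: A0; rewrite h1 ltW.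
  rewrite uS h0 /=.
  (* The strict decrease is given only on the open interval; at 0, where the orbit starts if
     [n = 1], the quadratic bound takes over. *)
  case: (ltgtP 0 (u i)) h1 => // [ui|ui] _.
    by apply: (lt_trans _ h2); apply: Alt; rewrite ui h2.
  by move: h3; rewrite -ui expr0n mulr0; lra.
have u0 i : 0 <= u i by case/andP: (ur i).
have u1 i : u i < 1 by case/andP: (ur i).
have uq i : u i.+1 <= C * u i ^+ 2.
  by have /andP[] : 0 <= A (u i) <= C * u i ^+ 2 by apply: A0; rewrite u0 ltW.
have ud i : u i.+1 <= u i.
  case: (ltgtP 0 (u i)) (u0 i) => // [ui|ui] _.
    by apply: ltW; apply: Alt; rewrite ui u1.
  by have := uq i; rewrite -ui expr0n mulr0.
have h1 : u J.*2 <= 1 - e.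
  apply: (@decreasing_expanding_le _ u e n%:R^-1 (3 / 2) J.*2) => //.
  - by move=> i ui; apply: A1; rewrite ui ltW.
  - by rewrite /u /=; lra.
  (* Two steps expand the gap by 9/4, hence at least double it; this is why [J.*2] steps suffice for
     [n <= 2 ^ J]. *)
  - rewrite ler_pdivlMr // mul1r -mul2n exprM.
    apply: (@le_trans _ _ (2 ^+ J)); first by rewrite -natrX ler_nat.
    by rewrite lerXn2r ?nnegrE; lra.
have h2 : u (J.*2 + T)%N <= a.
  apply: (hT (fun i => u (J.*2 + i)%N)) => // [i|i|].
  - by rewrite addnS.
  - by rewrite addnS ud.
  - by rewrite addn0.
apply: (@quadratic_decay _ (fun j => u (J.*2 + T + j)%N) C) => // [i|].
  by rewrite addnS.
rewrite addn0 mulrC -ler_pdivlMr // mulrC.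
by apply: le_trans h2 _; rewrite ge_min lexx.
Qed.

(** * Bounds on the characteristic polynomial near 0 and near 1 *)

Lemma horner_connective_poly (R : realType) (k : nat) (alpha : boolfun k)
    (p : R) :
  (connective_poly R alpha).[p] =
  \sum_(j < k.+1) beta R alpha j * ((1 - p) ^+ (k - j) * p ^+ j *+ 'C(k, j)).
Proof.
rewrite /connective_poly horner_sum; apply: eq_bigr => j _.
rewrite hornerZ hornerM hornerXn horner_exp hornerD hornerN hornerX hornerC.
by rewrite -mulrA -[in RHS]mulr_natl [_ ^+ (k - j) * _]mulrC.
Qed.

Lemma beta_itv (R : realType) (k : nat) (alpha : boolfun k) (j : nat) :
  0 <= beta R alpha j <= 1.
Proof.
rewrite /beta divr_ge0 ?ler0n //=.
case: (posnP #|[set x : assignment k | weight x == j]|) => [->|h].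
  by rewrite invr0 mulr0 ler01.
rewrite ler_pdivrMr ?ltr0n // mul1r ler_nat subset_leq_card //.
by apply/fintype.subsetP => x; rewrite !inE => /andP[].
Qed.

Lemma binomial_weight_ge0 (R : realType) (k j : nat) (p : R) :
  0 <= p <= 1 -> 0 <= (1 - p) ^+ (k - j) * p ^+ j *+ 'C(k, j).
Proof.
move=> /andP[p0 p1].
by rewrite mulrn_wge0 // mulr_ge0 // exprn_ge0 // subr_ge0.
Qed.

Lemma connective_poly_ge0 (R : realType) (k : nat) (alpha : boolfun k) (p : R) :
  0 <= p <= 1 -> 0 <= (connective_poly R alpha).[p].
Proof.
move=> hp; rewrite horner_connective_poly sumr_ge0 // => j _.
have /andP[b0 _] := beta_itv R alpha j.
by rewrite mulr_ge0 // binomial_weight_ge0.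
Qed.

(** The sum factors over coordinates: coordinate [j] is forced to be true and gives [p], each other
    one gives [p + (1 - p) = 1]. *)
Lemma sum_bernoulli_marginal (R : realType) (k : nat) (j : 'I_k) (p : R) :
  \sum_(x : assignment k | x j) \prod_(i < k) (if x i then p else 1 - p) = p.
Proof.
transitivity (\prod_(i < k) \sum_(b | (i == j) ==> b) (if b then p else 1 - p)).
  rewrite bigA_distr_big_dep; apply: eq_bigl => x; apply/idP/familyP.
    by move=> xj i; apply/implyP => /eqP ->.
  by move=> /(_ j) /implyP; apply.
rewrite (bigD1 j) //= [X in _ * X]big1 => [|i /negbTE ->].
  by rewrite mulr1 eqxx (big_pred1 true) // => -[].
by rewrite big_bool /= addrC subrK.
Qed.

(** A monotone [alpha] true at weight at most 1 lies above some projection, so its polynomial is at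
    least [p]; this contradicts [A p < p] at 1/2. *)
Lemma weight_gt1_of_true (R : realType) (k : nat) (alpha : boolfun k) :
  monotone_boolfun alpha ->
  (forall p : R, 0 < p < 1 -> (connective_poly R alpha).[p] < p) ->
  (0 < k)%N -> forall x, alpha x -> (1 < weight x)%N.
Proof.
move=> mono Alt k0 x ax; rewrite ltnNge; apply/negP => w1.
(* [j] is the only true coordinate of [x], or any coordinate if [x] has none. *)
have [j xj] : exists j, forall i, x i -> i = j.
  case: (pickP x) => [j xj|x0]; last by exists (Ordinal k0) => i; rewrite x0.
  by exists j => i xi; apply: (card_le1_eqP w1); rewrite inE.
have h : 0 < (2^-1 : R) < 1 by apply/andP; split; lra.
have := Alt _ h; rewrite connective_polyE ltNge => /negP; apply.
rewrite -[X in X <= _](sum_bernoulli_marginal j).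
rewrite [leRHS](bigID (fun y : assignment k => y j)) /=.
rewrite [X in X <= _](eq_bigl (fun y : assignment k => alpha y && y j)) => [|y].
  rewrite lerDl sumr_ge0 // => y _; apply: prodr_ge0 => i _.
  by case: (y i); lra.
case: (boolP (y j)) => yj; rewrite ?andbF ?andbT //; apply/esym.
apply: (implyP (mono x y _)) ax => i; apply/implyP => /xj ->.
exact: yj.
Qed.

Lemma beta_eq0 (R : realType) (k : nat) (alpha : boolfun k) (j : nat) :
  (forall x, alpha x -> weight x != j) -> beta R alpha j = 0.
Proof.
move=> h; rewrite /beta (_ : [set x | _ & _] = finset.set0) ?cards0 ?mul0r //.
apply/finset.setP => x; rewrite !inE; apply/negP => /andP[/eqP wx /h].
by rewrite wx eqxx.
Qed.

(** The terms of weight 0 and 1 vanish, each other term is at most ['C(k, j) * p ^+ 2], and the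
    binomial coefficients sum to [2 ^+ k]. *)
Lemma connective_poly_le_sqr (R : realType) (k : nat) (alpha : boolfun k)
    (p : R) :
  (forall x, alpha x -> (1 < weight x)%N) -> 0 <= p <= 1 ->
  (connective_poly R alpha).[p] <= 2 ^+ k * p ^+ 2.
Proof.
move=> aw /andP[p0 p1].
have -> : (2 : R) ^+ k = \sum_(j < k.+1) 'C(k, j)%:R.
  rewrite -[2]/(1 + 1) exprDn; apply: eq_bigr => j _.
  by rewrite !expr1n mulr1.
rewrite horner_connective_poly mulr_suml; apply: ler_sum => j _.
have [jk|jk] := ltnP j 2.
  rewrite beta_eq0 ?mul0r ?mulr_ge0 ?sqr_ge0 ?ler0n // => x /aw.
  by apply: contraTneq => ->; rewrite -leqNgt -ltnS.
have /andP[b0 b1] := beta_itv R alpha j.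
have q0 : 0 <= 1 - p by lra.
rewrite mulr_natl mulrnAr; rewrite lerMn2r; apply/orP; right.
rewrite -[leRHS]mul1r ler_pM ?mulr_ge0 ?exprn_ge0 //.
rewrite -[leRHS]mul1r ler_pM ?exprn_ge0 //; first by rewrite exprn_ile1 //; lra.
by rewrite ler_wiXn2l.
Qed.

(** Since the Bernstein weights sum to 1, [1 - A p] has the coefficients [1 - beta j >= 0]. Only the
    term [j = k - 1] is kept; the bound on [beta] says that [k * (1 - beta (k - 1)) >= 2]. *)
Lemma connective_poly_near1 (R : realType) (k : nat) (alpha : boolfun k)
    (p : R) :
  (0 < k)%N -> beta R alpha k.-1 <= (k%:R - 2) / k%:R -> 0 <= p <= 1 ->
  2 * p ^+ k.-1 * (1 - p) <= 1 - (connective_poly R alpha).[p].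
Proof.
move=> k0 hb hp.
have sum1 : \sum_(j < k.+1) ((1 - p) ^+ (k - j) * p ^+ j *+ 'C(k, j)) = 1.
  by rewrite -exprDn subrK expr1n.
rewrite -[X in _ <= X - _]sum1 horner_connective_poly -sumrB.
have kk : (k.-1 < k.+1)%N by rewrite ltnS leq_pred.
rewrite (bigD1 (Ordinal kk)) //=.
apply: ler_wpDr.
  rewrite sumr_ge0 // => j _; rewrite -[X in X - _]mul1r -mulrBl mulr_ge0 //.
    by rewrite subr_ge0; case/andP: (beta_itv R alpha j).
  exact: binomial_weight_ge0.
have -> : (k - k.-1 = 1)%N by lia.
have -> : 'C(k, k.-1) = k by rewrite -(subn1 k) bin_sub // bin1.
rewrite expr1 -(mulr_natl _ k).
have h2 : 2 <= (1 - beta R alpha k.-1) * k%:R.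
  by move: hb; rewrite ler_pdivlMr ?ltr0n //; lra.
have w0 : 0 <= (1 - p) * p ^+ k.-1.
  by case/andP: hp => p0 p1; rewrite mulr_ge0 ?exprn_ge0 ?subr_ge0.
have := ler_wpM2r w0 h2; lra.
Qed.

(** Within [1 / (4k)] of 1, Bernoulli's inequality gives [p ^+ k.-1 >= 3/4], and [2 * 3/4 = 3/2]. *)
Lemma connective_poly_repels1 (R : realType) (k : nat) (alpha : boolfun k)
    (p : R) :
  (0 < k)%N -> beta R alpha k.-1 <= (k%:R - 2) / k%:R ->
  1 - (4 * k%:R)^-1 <= p <= 1 ->
  3 / 2 * (1 - p) <= 1 - (connective_poly R alpha).[p].
Proof.
move=> k0 hb /andP[p0 p1].
have kr : 1 <= k%:R :> R by rewrite ler1n.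
have e0 : 0 <= 1 - p <= (4 * k%:R)^-1 by lra.
have [p01 h] : 0 <= 1 - p <= 1 /\ k%:R * (1 - p) <= 4^-1.
  case/andP: e0 => e0; rewrite invfM ler_pdivlMr; last lra.
  move=> e1; split; last lra.
  by rewrite e0 /=; nra.
apply: le_trans (connective_poly_near1 k0 hb _); last lra.
rewrite ler_wpM2r //; first by case/andP: p01.
have := bernoulli_le k.-1 p01; rewrite subKr.
have : k.-1%:R <= k%:R :> R by rewrite ler_nat leq_pred.
nra.
Qed.

(** * The growth process for a general initial distribution *)

Section GrowthProcess.

Variables (R : realType) (k n : nat) (mu : boolfun n -> R) (alpha : boolfun k).
Hypotheses (mu_ge0 : forall f, 0 <= mu f) (mu_sum1 : \sum_f mu f = 1).

Lemma growth_ge0 (i : nat) (f : boolfun n) : 0 <= growth mu alpha i f.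
Proof.
elim: i f => [|i IH] f //=.
by apply: sumr_ge0 => g _; apply: prodr_ge0.
Qed.

Lemma growth_sumS (i : nat) (P : pred (boolfun n)) :
  \sum_(f | P f) growth mu alpha i.+1 f =
  \sum_(g : {ffun 'I_k -> boolfun n} | P (boolfun_comp alpha g))
    \prod_(j < k) growth mu alpha i (g j).
Proof.
rewrite [RHS](partition_big (boolfun_comp alpha) P) //=.
apply: eq_bigr => f Pf; apply: eq_bigl => g.
by case: eqP => [->|]; rewrite ?Pf ?andbT ?andbF.
Qed.

Lemma growth_sum1 (i : nat) : \sum_f growth mu alpha i f = 1.
Proof.
elim: i => [|i IH] //; rewrite growth_sumS.
by rewrite -(bigA_distr_bigA (fun=> growth mu alpha i)) big1.
Qed.

(** At a fixed [x] the values [g j x] are independent Bernoulli variables, so grouping the tuples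
    [g] by their value vector [ev g] produces the polynomial. *)
Lemma growth_evalS (i : nat) (x : assignment n) :
  \sum_(f : boolfun n | f x) growth mu alpha i.+1 f =
  (connective_poly R alpha).[\sum_(f : boolfun n | f x) growth mu alpha i f].
Proof.
set p := \sum_(f : boolfun n | f x) growth mu alpha i f.
have pC : \sum_(f : boolfun n | ~~ f x) growth mu alpha i f = 1 - p.
  rewrite -(growth_sum1 i) [in RHS](bigID (fun f : boolfun n => f x)) /=.
  by rewrite /p addrAC subrr add0r.
rewrite growth_sumS connective_polyE.
pose ev (g : {ffun 'I_k -> boolfun n}) : assignment k := [ffun j => g j x].
rewrite (partition_big ev (fun y => alpha y)) => [|g]; last by rewrite ffunE.
apply: eq_bigr => y ay.
transitivity (\prod_(j < k) \sum_(f : boolfun n | f x == y j)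
                growth mu alpha i f).
  rewrite bigA_distr_big_dep; apply: eq_bigl => g.
  apply/andP/familyP => [[_ /eqP <-] j|h].
    by rewrite /in_mem /= ffunE.
  have gy : ev g = y by apply/ffunP => j; rewrite ffunE; apply/eqP; exact: h.
  by rewrite ffunE -/(ev g) gy.
apply: eq_bigr => j _; case: (y j).
  by apply: eq_bigl => f; rewrite eqb_id.
by rewrite -pC; apply: eq_bigl => f; rewrite eqbF_neg.
Qed.

Lemma growth_eval (i : nat) (x : assignment n) :
  \sum_(f : boolfun n | f x) growth mu alpha i f =
  iter i (horner (connective_poly R alpha)) (\sum_(f : boolfun n | f x) mu f).
Proof. by elim: i => [//|i IH]; rewrite growth_evalS IH. Qed.

Lemma growth_support (Q : boolfun n -> Prop) :
  (forall f, ~ Q f -> mu f = 0) ->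
  (forall g : {ffun 'I_k -> boolfun n},
     (forall j, Q (g j)) -> Q (boolfun_comp alpha g)) ->
  forall i f, ~ Q f -> growth mu alpha i f = 0.
Proof.
move=> Qmu Qcomp; elim=> [|i IH] f nQ /=; first exact: Qmu.
apply: big1 => g /eqP gf.
have [j nQj] : exists j, ~ Q (g j).
  by apply/existsNP => Qg; apply: nQ; rewrite -gf; apply: Qcomp.
by rewrite (bigD1 j) //= IH ?mul0r.
Qed.

End GrowthProcess.

(** At [a] the deviation is exactly the mass outside [a]; at any other point it is one summand of
    that mass. *)
Lemma dist_dirac_le (R : realType) (T : finType) (mu : T -> R) (a : T) :
  (forall f, 0 <= mu f) -> \sum_f mu f = 1 ->
  forall f, `|mu f - (f == a)%:R| <= \sum_(h | h != a) mu h.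
Proof.
move=> mu0 mu1 f; rewrite (bigD1 a) //= in mu1.
have [->|fa] := eqVneq f a.
  by rewrite -mu1 opprD addNKr normrN ger0_norm // sumr_ge0.
rewrite subr0 ger0_norm // (bigD1 f) //= lerDl.
exact: sumr_ge0.
Qed.

(** * Uniform projections and the union bound over assignments of weight [n - 1] *)

Definition all_but (n : nat) (j : 'I_n) : assignment n := [ffun i => i != j].

Definition conj_all (n : nat) : boolfun n :=
  [ffun x : assignment n => [forall i, x i]].

Lemma projection_inj (n : nat) : injective (@projection n).
Proof.
move=> i j /ffunP/(_ (all_but j)); rewrite !ffunE eqxx.
by move/negbFE/eqP.
Qed.

(** Presents the distribution as the image of the uniform one on indices, so that sums over
    functions become sums over indices; injectivity leaves at most one summand. *)
Lemma uniform_projectionsE (R : realType) (n : nat) (f : boolfun n) :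
  uniform_projections R f = \sum_(l < n | projection l == f) n%:R^-1.
Proof.
rewrite /uniform_projections; case: (boolP (f \in _)) => [/codomP[j ->]|h].
  rewrite (eq_bigl (pred1 j)) ?big_pred1_eq // => l /=.
  exact/inj_eq/projection_inj.
rewrite big_pred0 // => l; apply/negP => /eqP lf.
by move/negP: h; apply; rewrite -lf codom_f.
Qed.

Lemma uniform_projections_sum (R : realType) (n : nat) (P : pred (boolfun n)) :
  \sum_(f | P f) uniform_projections R f =
  \sum_(l < n | P (projection l)) n%:R^-1.
Proof.
rewrite (eq_bigr _ (fun f _ => uniform_projectionsE R f)).
rewrite [RHS](partition_big (@projection n) P) //=.
apply: eq_bigr => f Pf; apply: eq_bigl => l.
by case: eqP => [->|]; rewrite ?Pf ?andbT ?andbF.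
Qed.

Lemma uniform_projections_ge0 (R : realType) (n : nat) (f : boolfun n) :
  0 <= uniform_projections R f.
Proof. by rewrite /uniform_projections; case: ifP; rewrite ?invr_ge0. Qed.

Lemma uniform_projections_sum1 (R : realType) (n : nat) :
  (0 < n)%N -> \sum_f @uniform_projections R n f = 1.
Proof.
move=> n0; rewrite uniform_projections_sum sumr_const card_ord.
by rewrite -[LHS]mulr_natl mulfV // pnatr_eq0 -lt0n.
Qed.

Lemma uniform_projections_all_but (R : realType) (n : nat) (j : 'I_n) :
  \sum_(f : boolfun n | f (all_but j)) uniform_projections R f = 1 - n%:R^-1.
Proof.
have n0 : (0 < n)%N by apply: leq_ltn_trans (ltn_ord j).
have := uniform_projections_sum1 R n0.
rewrite !uniform_projections_sum (bigD1 j) //= addrC => /(canRL (addrK _)) <-.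
by apply: eq_bigl => l; rewrite !ffunE.
Qed.

Lemma growth_neq_conj_all_le (R : realType) (k n : nat) (alpha : boolfun k)
    (i : nat) :
  monotone_boolfun alpha -> alpha [ffun=> true] -> (0 < n)%N ->
  \sum_(f | f != conj_all n) growth (@uniform_projections R n) alpha i f <=
  n%:R * iter i (horner (connective_poly R alpha)) (1 - n%:R^-1).
Proof.
move=> mono a1 n0.
pose Q (f : boolfun n) := monotone_boolfun f /\ f [ffun=> true].
set pi := growth _ alpha i.
have pi0 f : 0 <= pi f by apply: growth_ge0; apply: uniform_projections_ge0.
have piQ f : ~ Q f -> pi f = 0.
  apply: (growth_support (Q := Q)) => [{}f|g Qg].
    move=> nQ; rewrite /uniform_projections; case: ifP => // /codomP[j fj].
    case: nQ; rewrite fj; split; last by rewrite !ffunE.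
    by move=> x y xy; rewrite !ffunE.
  split.
    move=> x y xy; rewrite !ffunE; apply: mono => j; rewrite !ffunE.
    by case: (Qg j) => h _; apply: h.
  rewrite ffunE; suff -> : [ffun j => g j [ffun=> true]] = [ffun=> true] by [].
  by apply/ffunP => j; rewrite !ffunE; case: (Qg j).
have -> : n%:R * iter i (horner (connective_poly R alpha)) (1 - n%:R^-1) =
    \sum_(j < n) \sum_(f : boolfun n | f (all_but j)) pi f.
  rewrite mulr_natl -[X in _ *+ X]card_ord -sumr_const; apply: eq_bigr => j _.
  rewrite growth_eval ?uniform_projections_all_but //.
  exact: uniform_projections_sum1.
(* After the exchange each [pi f] is counted once for every [j] with [f (all_but j)]; at least one
   such [j] is needed when [f] is in [Q] and is not the conjunction. *)
rewrite (exchange_big_dep xpredT) //=.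
rewrite [leRHS](bigID (fun f => f != conj_all n)) /=.
apply: ler_wpDr; first by apply: sumr_ge0 => f _; apply: sumr_ge0.
apply: ler_sum => f fneq.
have [[fm f1]|/piQ ->] := pselect (Q f); last by rewrite sumr_ge0.
have [j fj] : exists j, f (all_but j).
  apply/existsP; apply: contraNT fneq; rewrite negb_exists => /forallP h.
  apply/eqP/ffunP => x; rewrite ffunE.
  case: (boolP [forall _, _]) => [/forallP xt|].
    by rewrite (_ : x = [ffun=> true]) //; apply/ffunP => l; rewrite ffunE xt.
  (* An assignment that is false at [j] lies below [all_but j], so monotonicity carries falsity down
     to it. *)
  rewrite negb_forall => /existsP[j xj]; apply: contraNF (h j) => fx.
  apply: (implyP (fm x _ _)) fx => l; rewrite ffunE; apply/implyP.
  by apply: contraTneq => ->.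
by rewrite (bigD1 j) //= lerDl sumr_ge0.
Qed.

Lemma growth_const0 (R : realType) (k n : nat) (mu : boolfun n -> R)
    (alpha : boolfun k) (i : nat) :
  (forall x, ~~ alpha x) ->
  \sum_(f | f != [ffun=> false]) growth mu alpha i.+1 f = 0.
Proof.
move=> a0; rewrite growth_sumS big_pred0 // => g.
by apply/negbF/eqP/ffunP => x; rewrite !ffunE; apply/negbTE/a0.
Qed.

(** * Rounding of logarithms and the final estimate *)

Lemma up_log2_le (R : realType) (n : nat) :
  (0 < n)%N -> (up_log 2 n)%:R <= log2 n%:R + 1 :> R.
Proof.
move=> n0; have ln20 : 0 < ln 2 :> R by rewrite ln_gt0 // ltr1n.
case: (ltnP 1 n) => [n1|n1]; last first.
  have -> : n = 1%N by apply/eqP; rewrite eqn_leq n1 n0.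
  by rewrite up_log1 /log2 ln1 mul0r add0r ler01.
have := up_log_gtn (isT : (1 < 2)%N) n1.
have : (0 < up_log 2 n)%N by rewrite up_log_gt0.
case: (up_log 2 n) => // J _ /= hJ.
rewrite -natr1 lerD2r /log2 ler_pdivlMr //.
rewrite mulr_natl -lnXn ?ltr0n // ler_ln ?posrE ?exprn_gt0 ?ltr0n //.
by rewrite -natrX ler_nat ltnW.
Qed.

Unset Implicit Arguments.
Set Strict Implicit.

Theorem theorem5p9 (R : realType) (k : nat) (alpha : boolfun k)
    (alpha_monotone : monotone_boolfun alpha)
    (A_lt : forall p : R, 0 < p < 1 -> (connective_poly R alpha).[p] < p)
    (k_gt2 : (2 < k)%N)
    (beta_le : beta R alpha k.-1 <= (k%:R - 2) / k%:R) :
  exists c : R, forall n : nat, (0 < n)%N ->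
    (forall f : boolfun n,
       cvgn (fun i => growth (@uniform_projections R n) alpha i f)) /\
    (forall i : nat, 3 * log2 n%:R + c <= i%:R ->
       forall f : boolfun n,
         `|growth (@uniform_projections R n) alpha i f
           - growth_limit (@uniform_projections R n) alpha f| < 2 ^- n).
Proof.
have k0 : (0 < k)%N by apply: ltn_trans k_gt2.
(* It suffices that the process concentrates on one function [F] with this error; the limit is then
   the point mass at [F]. *)
suff [T hT] : exists T : nat, forall n : nat, (0 < n)%N ->
    exists F : boolfun n, forall j : nat,
    \sum_(f | f != F) growth (@uniform_projections R n) alpha
      ((up_log 2 n).*2 + T + j) f <= n%:R * 4^-1 ^+ (2 ^ j).
  (* The 3 pays for rounding [log2 n] up three times: twice in [s] and once in the remaining [i - s]
     steps. *)
  exists (T%:R + 3) => n n0; have {hT}[F hF] := hT n n0.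
  set pi := growth _ _ in hF *.
  set s := ((up_log 2 n).*2 + T)%N in hF.
  have dev j f : `|pi (s + j)%N f - (f == F)%:R| <= n%:R * 4^-1 ^+ (2 ^ j).
    apply: le_trans (hF j); apply: dist_dirac_le.
      by apply: growth_ge0; apply: uniform_projections_ge0.
    exact/growth_sum1/uniform_projections_sum1.
  have picvg f : (pi i f @[i --> \oo] --> ((f == F)%:R : R))%classic.
    rewrite -(cvg_shiftn s) /=.
    apply/subr_cvg0/norm_cvg0P.
    apply: (@squeeze_cvgr _ _ _ _ (fun=> 0) (geometric n%:R 4^-1)).
    - apply: nearW => j; rewrite normr_ge0 /= addnC (le_trans (dev j f)) //.
      rewrite ler_wpM2l ?ler0n // ler_wiXn2l ?invr_ge0 ?ler0n //; first lra.
      exact/ltnW/ltn_expl.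
    - exact: cvg_cst.
    - by apply: cvg_geometric; rewrite ger0_norm; lra.
  split=> [f|i hi f]; first by apply/cvg_ex; exists (f == F)%:R; apply: picvg.
  have -> : growth_limit (@uniform_projections R n) alpha f = (f == F)%:R.
    exact/cvg_lim/picvg.
  have sJ : (s + up_log 2 n <= i)%N.
    rewrite -(ler_nat R); apply: le_trans hi.
    have := up_log2_le R n0.
    rewrite /s -addnn !natrD; lra.
  have -> : i = (s + (i - s))%N by rewrite subnKC // (leq_trans _ sJ) ?leq_addr.
  apply: le_lt_trans (dev _ _) _.
  (* Hence the error is at most [n * 4^-n = (n * 2^-n) * 2^-n], which is below [2^-n] because
     [n < 2^n]. *)
  have nJ : (n <= 2 ^ (i - s))%N.
    apply: leq_trans (@up_logP 2 n isT) _.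
    by rewrite leq_exp2l //; lia.
  apply: (@le_lt_trans _ _ (n%:R * 4^-1 ^+ n)).
    by rewrite ler_wpM2l ?ler0n // ler_wiXn2l ?invr_ge0 ?ler0n //; lra.
  have -> : (4 : R) = 2 * 2 by ring.
  rewrite invfM exprMn mulrA -exprVn gtr_pMl // ?exprn_gt0 ?invr_gt0 //.
  by rewrite exprVn ltr_pdivrMr ?exprn_gt0 // mul1r -natrX ltr_nat ltn_expl.
have [a1|a1] := boolP (alpha [ffun=> true]).
  have kr : 1 <= k%:R :> R by rewrite ler1n.
  have aw := weight_gt1_of_true alpha_monotone A_lt k0.
  have [||||T hT] := @iter_superexp_decay R (horner (connective_poly R alpha))
    (2 ^+ k) (4 * k%:R)^-1 _ _ _ _ A_lt
    (fun p => connective_poly_repels1 k0 beta_le).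
  - exact: continuous_horner.
  - by rewrite exprn_ege1 // ler1n.
  - by rewrite invr_gt0 invf_lt1; lra.
  - move=> p hp; rewrite connective_poly_ge0 //=.
    exact: connective_poly_le_sqr.
  exists T => n n0; exists (conj_all n) => j.
  apply: le_trans (growth_neq_conj_all_le R _ alpha_monotone a1 n0) _.
  by rewrite ler_wpM2l ?ler0n // hT ?up_logP.
(* A monotone connective false at the top is constantly false, and a single step moves all mass to
   the constant false function; hence [T = 1]. *)
have a0 x : ~~ alpha x.
  apply: contra a1; apply: (implyP (alpha_monotone _ _ _)) => j.
  by rewrite ffunE implybT.
exists 1%N => n n0; exists [ffun=> false] => j.
by rewrite addn1 addSn growth_const0.
Qed.
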